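(* Let $\gamma>0$ be a given disturbance attenuation level and suppose $\{w_k\}_{k\in\mathcal N}$ is a sequence of independent identically distributed random variables. Consider the time-invariant system $x_{k+1}=f(x_k,w_k,v_k)$, $y_k=g(x_k,v_k)$, $z_k=m(x_k,v_k)$ and the filter $\hat x_{k+1}=\hat f(\hat x_k)+\hat g(y_k)$, $\hat z_k=\hat m(\hat x_k)$, with augmented system $\eta_{k+1}=\tilde f(\eta_k,w_k,v_k)$, $\tilde z_k=\tilde m(\eta_k,v_k)$ as described in the context. Suppose there exist a positive radially unbounded Lyapunov function $V:\mathcal R^{n_\eta}\to[0,\infty)$ and a positive radially unbounded function $W:\mathcal R^{n_\eta}\to[0,\infty)$ such that $$\|\tilde m(\eta,0)\|^2\ge W(\eta)\quad\text{for all }\eta\in\mathcal R^{n_\eta},$$ and $$E[V(\tilde f(\eta,w_0,v))]-V(\eta)+\|\tilde m(\eta,v)\|^2-\gamma^2\|v\|^2\le0\quad\text{for all }\eta\in\mathcal R^{n_\eta},\ v\in\mathcal R^{n_v}.$$ Then the filter is a desired $H_\infty$ filter for the system, i.e. the augmented system is both internally stable and externally stable (with level $\gamma$).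
   Context: $\mathcal N=\{0,1,2,\dots\}$. The $w_k$ are $\mathcal R^{n_w}$-valued random variables on a complete probability space $(\Omega,\mathcal F,\mathcal P)$, $\mathcal F_0=\{\emptyset,\Omega\}$, $\mathcal F_k=\sigma(w_0,\dots,w_{k-1})$. $l^2_\infty(\Omega,\mathcal F,\{\mathcal F_k\},\mathcal R^{n_v})$ is the space of $\mathcal F_k$-adapted sequences $v=\{v_k\}$ with $\|v\|^2_{l^2_\infty}=E\sum_{k\ge0}\|v_k\|^2<\infty$. System: $x_k\in\mathcal R^n$, $y_k\in\mathcal R^{n_y}$, $z_k\in\mathcal R^{n_z}$, disturbance $v_k\in\mathcal R^{n_v}$; $f,g,m$ are continuous with $f(0,0,0)=0$, $g(0,0)=0$, $m(0,0)=0$. Filter: $\hat x_k\in\mathcal R^{n_{\hat x}}$, $\hat x_0=0$, with (Borel measurable) maps satisfying $\hat f(0)=\hat g(0)=0$, $\hat m(0)=0$. Augmented system: $\eta_k=\begin{bmatrix}x_k\\ \hat x_k\end{bmatrix}\in\mathcal R^{n_\eta}$, $\tilde z_k=z_k-\hat z_k$, and for $\eta=\begin{bmatrix}x\\ \hat x\end{bmatrix}$, $\tilde f(\eta,w,v)=\begin{bmatrix}f(x,w,v)\\ \hat f(\hat x)+\hat g(g(x,v))\end{bmatrix}$, $\tilde m(\eta,v)=m(x,v)-\hat m(\hat x)$. A positive radially unbounded function $U$ on $\mathcal R^{n_\eta}$: continuous, $U(0)=0$, $U(\eta)>0$ for $\eta\ne0$, $\liminf_{\|\eta\|\to\infty}U(\eta)=\infty$.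 Internally stable: with $v\equiv0$, the solution $\eta_k^{0,\eta_0,0}$ of $\eta_{k+1}=\tilde f(\eta_k,w_k,0)$ starting at time $0$ from deterministic $\eta_0\in\mathcal R^{n_\eta}$ satisfies: for every $\varepsilon>0$, $\lim_{\eta_0\to0}\mathcal P(\sup_{k\ge0}\|\eta_k^{0,\eta_0,0}\|>\varepsilon)=0$; and $\mathcal P(\lim_{k\to\infty}\eta_k^{0,\eta_0,0}=0)=1$ for every $\eta_0$. Externally stable (level $\gamma$): for every nonzero $v\in l^2_\infty(\Omega,\mathcal F,\{\mathcal F_k\},\mathcal R^{n_v})$ and $\eta_0=0$, $\|\tilde z\|^2_{l^2_\infty}\le\gamma^2\|v\|^2_{l^2_\infty}$. *)

(* Defs.v *)
(* Vectors of R^n are rows; the library norm on them is the sup norm, so the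
   Euclidean norm is [enorm] below. *)
From HB Require Import structures.
From mathcomp Require Import all_boot all_order all_algebra.
From mathcomp Require Import finmap.
From mathcomp Require Import all_classical all_reals all_analysis.

Set Implicit Arguments.
Unset Strict Implicit.
Unset Printing Implicit Defensive.

Import Order.TTheory GRing.Theory Num.Theory.
Import numFieldNormedType.Exports.

Local Open Scope classical_set_scope.
Local Open Scope ring_scope.

(* R^n with its Borel sigma-algebra. *)
Notation borel_rV R n := (g_sigma_algebraType (@open 'rV[R]_n)).

Definition enorm (R : realType) n (x : 'rV[R]_n) : R :=
  Num.sqrt (\sum_(i < n) x 0 i ^+ 2).

Definition enorm_infty (R : realType) n : set_system 'rV[R]_n :=
  filter_from [set: R] (fun r => [set x | r < enorm x]).

Definition positive_radially_unbounded (R : realType) n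
    (U : 'rV[R]_n -> R) : Prop :=
  [/\ continuous U, U 0 = 0, (forall x, x != 0 -> 0 < U x) &
      limf_einf (fun x => (U x)%:E) (@enorm_infty R n) = +oo%E].

Section probability_notions.
Context d (T : measurableType d) (R : realType) (P : probability T R).

Definition mutually_independent d' (E : measurableType d')
    (w : nat -> {RV P >-> E}) : Prop :=
  forall (J : {fset nat}) (B : nat -> set E), (forall i, measurable (B i)) ->
    P (\bigcap_(i in [set` J]) (w i @^-1` B i)) =
    (\prod_(i <- J) P (w i @^-1` B i))%E.

Definition identically_distributed d' (E : measurableType d')
    (w : nat -> {RV P >-> E}) : Prop :=
  forall i j (B : set E), measurable B ->
    distribution P (w i) B = distribution P (w j) B.

(* The sigma-algebra generated by w_0, ..., w_(k-1); trivial for k = 0. *)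
Definition noise_filtration d' (E : measurableType d')
    (w : nat -> {RV P >-> E}) (k : nat) : set (set T) :=
  g_sigma_preimage (fun i : 'I_k => w i : T -> E).

Definition adapted n (F : nat -> set (set T)) (v : nat -> T -> 'rV[R]_n) :=
  forall k (B : set (borel_rV R n)), measurable B -> F k (v k @^-1` B).

Definition l2_sqnorm n (v : nat -> T -> 'rV[R]_n) : \bar R :=
  (\int[P]_t \sum_(0 <= k <oo) (enorm (v k t) ^+ 2)%:E)%E.

Definition in_l2 n (F : nat -> set (set T)) (v : nat -> T -> 'rV[R]_n) :=
  adapted F v /\ (l2_sqnorm v < +oo)%E.

End probability_notions.

Section augmented_system.
Context (R : realType) (n nh nw nv ny nz : nat).

Definition aug_dynamics
    (f : 'rV[R]_n -> 'rV[R]_nw -> 'rV[R]_nv -> 'rV[R]_n)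
    (g : 'rV[R]_n -> 'rV[R]_nv -> 'rV[R]_ny)
    (fh : 'rV[R]_nh -> 'rV[R]_nh) (gh : 'rV[R]_ny -> 'rV[R]_nh)
    (eta : 'rV[R]_(n + nh)) (w : 'rV[R]_nw) (v : 'rV[R]_nv)
    : 'rV[R]_(n + nh) :=
  let x := lsubmx eta in let xh := rsubmx eta in
  row_mx (f x w v) (fh xh + gh (g x v)).

Definition aug_output
    (m : 'rV[R]_n -> 'rV[R]_nv -> 'rV[R]_nz) (mh : 'rV[R]_nh -> 'rV[R]_nz)
    (eta : 'rV[R]_(n + nh)) (v : 'rV[R]_nv) : 'rV[R]_nz :=
  m (lsubmx eta) v - mh (rsubmx eta).

End augmented_system.

Section stability.
Context d (T : measurableType d) (R : realType) (P : probability T R).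
Context (N nw nv nz : nat) (w : nat -> {RV P >-> borel_rV R nw}).
Variable F : 'rV[R]_N -> 'rV[R]_nw -> 'rV[R]_nv -> 'rV[R]_N.

Fixpoint trajectory (v : nat -> T -> 'rV[R]_nv) (eta0 : 'rV[R]_N)
    (k : nat) (t : T) : 'rV[R]_N :=
  if k is j.+1 then F (trajectory v eta0 j t) (w j t) (v j t) else eta0.

Definition internally_stable : Prop :=
  let eta eta0 := trajectory (fun _ _ => 0) eta0 in
  (forall e : R, 0 < e ->
     P [set t | e%:E < ereal_sup [set (enorm (eta eta0 k t))%:E | k in setT]]%E
       @[eta0 --> (0 : 'rV[R]_N)^'] --> 0%E) /\
  (forall eta0, P [set t | eta eta0 k t @[k --> \oo] --> (0 : 'rV[R]_N)] = 1%E).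

(* Sequences in l2 are identified when they agree almost surely, so a nonzero
   disturbance is one of nonzero norm. *)
Definition externally_stable (M : 'rV[R]_N -> 'rV[R]_nv -> 'rV[R]_nz)
    (gamma : R) : Prop :=
  forall v : nat -> T -> 'rV[R]_nv,
    in_l2 P (noise_filtration w) v -> l2_sqnorm P v != 0%E ->
    (l2_sqnorm P (fun k t => M (trajectory v 0 k t) (v k t))
       <= (gamma ^+ 2)%:E * l2_sqnorm P v)%E.

End stability.

(* Main.v *)
Require Import Defs.
From HB Require Import structures.
From mathcomp Require Import all_boot all_order all_algebra.
From mathcomp Require Import finmap.
From mathcomp Require Import all_classical all_reals all_analysis.
From mathcomp Require Import measurable_realfun lra.

Set Implicit Arguments.
Unset Strict Implicit.
Unset Printing Implicit Defensive.

Import Order.TTheory GRing.Theory Num.Theory.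
Import numFieldNormedType.Exports.

Local Open Scope classical_set_scope.
Local Open Scope ring_scope.

(** Conditioning on the past turns the dissipation inequality into
      E V(eta_(k+1)) + E |z_k|^2 <= E V(eta_k) + gamma^2 E |v_k|^2,
    because w_k is independent of F_k and has the law of w_0, while eta_k and
    v_k are F_k-measurable.  Summing over k gives external stability and, for
    v = 0, E (sum_k W(eta_k)) <= V(eta_0), hence W(eta_k) -> 0 and
    eta_k -> 0 almost surely.  The maximal inequality
    P(sup_k |eta_k| > e) <= V(eta_0) / inf_(|x| >= e) V follows by applying the
    same summation to the dynamics frozen at the first exit from the ball of
    radius e. *)

(** * Borel sets of R^n *)

Section borel_row_vectors.
Context (R : realType).

Definition rV_box n (c : 'rV[R]_n) (e : R) : set 'rV[R]_n :=
  [set y | forall j, ball (c 0 j) e (y 0 j)].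

(** Balls of the sup norm are boxes, and rational centres and radii suffice by density. The index
    set is thus countable, which the measurability criterion below relies on. *)
Lemma open_bigcup_rV_box n (U : set 'rV[R]_n) : open U ->
  U = \bigcup_(i in [set i : 'rV[rat]_n * rat |
                      rV_box (map_mx ratr i.1) (ratr i.2) `<=` U])
        rV_box (map_mx ratr i.1) (ratr i.2).
Proof.
move=> oU; apply/seteqP; split; last by move=> x [i iU]; exact: iU.
move=> x Ux.
have /nbhs_ballP[e /= e0 eU] : nbhs x U by apply: open_nbhs_nbhs.
(* With a centre within [q] of [x] in every coordinate, the box contains [x] and stays within
   [2q < e] of it. *)
have [q] := @rat_in_itvoo R 0 (e / 2) ltac:(by rewrite divr_gt0).
rewrite in_itv/= => /andP[q0 qe].
have cP j : {c : rat | ball (x 0 j) (ratr q) (ratr c)}.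
  have xq : x 0 j - ratr q < x 0 j + ratr q by rewrite ltrBlDr -addrA ltrDl addr_gt0.
  have /cid[c /[!in_itv]/= /andP[c1 c2]] := rat_in_itvoo xq.
  by exists c; rewrite /ball/= distrC ltr_distl c1.
exists (\row_j sval (cP j), q) => /=.
  move=> y cy; apply: eU; split=> // i j; rewrite ord1.
  have := cy j; rewrite !mxE => h2; have := svalP (cP j) => h1.
  by have := ball_triangle h1 h2; apply: le_ball; rewrite [leRHS](splitr e) lerD// ltW.
by move=> j; rewrite !mxE; exact/ball_sym/(svalP (cP j)).
Qed.

(** It suffices to pull back open sets; each is a countable union of boxes, and the preimage of a
    box is a finite intersection of coordinate preimages. *)
Lemma measurable_fun_rV d (T : measurableType d) n (X : T -> 'rV[R]_n) :
  (forall j, measurable_fun setT (fun t => X t 0 j)) ->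
  measurable_fun setT (X : T -> borel_rV R n).
Proof.
move=> mX; apply: (@measurability _ _ _ (borel_rV R n) setT X open erefl).
move=> _ [U oU <-]; rewrite (open_bigcup_rV_box oU) setTI preimage_bigcup bigcup_mkcond.
apply: countable_bigcupT_measurable => // i; case: ifPn => // _.
rewrite [X in measurable X](_ : _ = \bigcap_(j in [set: 'I_n])
  ((fun t => X t 0 j) @^-1` ball ((map_mx ratr i.1 : 'rV[R]_n) 0 j) (ratr i.2))).
  apply: fin_bigcap_measurable => // j _; rewrite -[X in measurable X]setTI.
  by apply: mX => //; exact: measurable_ball.
by apply/seteqP; split => t h j; [move=> _; exact: h|exact: h].
Qed.

Lemma continuous_borel_measurable (T1 T2 : ptopologicalType) (h : T1 -> T2) :
  continuous h ->
  measurable_fun setT (h : g_sigma_algebraType (@open T1) ->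
                           g_sigma_algebraType (@open T2)).
Proof.
move=> /continuousP ch.
apply: (@measurability _ _ (g_sigma_algebraType (@open T1))
  (g_sigma_algebraType (@open T2)) setT h open erefl) => _ [U oU <-].
by rewrite setTI; apply: sub_sigma_algebra; exact: ch.
Qed.

Lemma continuous_measurable_real (T1 : ptopologicalType) (h : T1 -> R) :
  continuous h -> measurable_fun setT (h : g_sigma_algebraType (@open T1) -> R).
Proof.
move=> /continuousP ch.
apply: (measurability _ (RGenOpens.measurableE R)) => _ [_ [a [b ->] <-]].
by rewrite setTI; apply: sub_sigma_algebra; exact: ch.
Qed.

Lemma measurable_rV_coord n (j : 'I_n) :
  measurable_fun setT ((fun x => x 0 j) : borel_rV R n -> R).
Proof. by apply: continuous_measurable_real; exact: coord_continuous. Qed.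

Lemma measurable_row_mx d (T : measurableType d) a b
    (X : T -> borel_rV R a) (Y : T -> borel_rV R b) :
  measurable_fun setT X -> measurable_fun setT Y ->
  measurable_fun setT ((fun t => row_mx (X t) (Y t)) : T -> borel_rV R (a + b)).
Proof.
move=> mX mY; apply: measurable_fun_rV => j.
case: (split_ordP j) => k ->.
- under eq_fun do rewrite row_mxEl.
  exact: (measurableT_comp (measurable_rV_coord k) mX).
- under eq_fun do rewrite row_mxEr.
  exact: (measurableT_comp (measurable_rV_coord k) mY).
Qed.

Lemma continuous_pair (S T1 T2 : topologicalType) (h1 : S -> T1) (h2 : S -> T2) :
  continuous h1 -> continuous h2 -> continuous (fun x => (h1 x, h2 x)).
Proof. by move=> c1 c2 x; exact: (cvg_pair (c1 x) (c2 x)). Qed.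

Lemma continuous_lsubmx a b : continuous (@lsubmx R 1 a b).
Proof.
move=> x U /nbhs_ballP[e /= e0 eU]; apply/nbhs_ballP; exists e => //= y [_ xy].
by apply: eU; split=> // i j; rewrite !mxE; exact: xy.
Qed.

Lemma continuous_rsubmx a b : continuous (@rsubmx R 1 a b).
Proof.
move=> x U /nbhs_ballP[e /= e0 eU]; apply/nbhs_ballP; exists e => //= y [_ xy].
by apply: eU; split=> // i j; rewrite !mxE; exact: xy.
Qed.

Lemma measurable_lsubmx a b :
  measurable_fun setT (@lsubmx R 1 a b : borel_rV R (a + b) -> borel_rV R a).
Proof. by apply: continuous_borel_measurable; exact: continuous_lsubmx. Qed.

Lemma measurable_rsubmx a b :
  measurable_fun setT (@rsubmx R 1 a b : borel_rV R (a + b) -> borel_rV R b).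
Proof. by apply: continuous_borel_measurable; exact: continuous_rsubmx. Qed.

(** Continuity of [h] speaks of the product topology, measurability of the pair of the product
    sigma-algebra. Gluing the two vectors into one row of length [a + b] bridges them, since there
    only Borel sets of a single space occur. *)
Lemma continuous2_measurable d (T : measurableType d) (S : ptopologicalType) a b
    (h : 'rV[R]_a * 'rV[R]_b -> S) (X : T -> borel_rV R a) (Y : T -> borel_rV R b) :
  continuous h -> measurable_fun setT X -> measurable_fun setT Y ->
  measurable_fun setT
    ((fun t => h (X t, Y t)) : T -> g_sigma_algebraType (@open S)).
Proof.
move=> ch mX mY.
pose h' (u : 'rV[R]_(a + b)) := h (lsubmx u, rsubmx u).
have ch' : continuous h'.
  move=> u; apply: (@continuous_comp _ _ _ (fun u => (lsubmx u, rsubmx u)) h).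
    exact: (continuous_pair (@continuous_lsubmx _ _) (@continuous_rsubmx _ _)).
  exact: ch.
have := measurableT_comp (continuous_borel_measurable ch') (measurable_row_mx mX mY).
by apply: eq_measurable_fun => t _ /=; rewrite /h' row_mxKl row_mxKr.
Qed.

Lemma continuous3_measurable d (T : measurableType d) (S : ptopologicalType) a b c
    (h : 'rV[R]_a * 'rV[R]_b * 'rV[R]_c -> S) (X : T -> borel_rV R a)
    (Y : T -> borel_rV R b) (Z : T -> borel_rV R c) :
  continuous h -> measurable_fun setT X -> measurable_fun setT Y ->
  measurable_fun setT Z ->
  measurable_fun setT
    ((fun t => h (X t, Y t, Z t)) : T -> g_sigma_algebraType (@open S)).
Proof.
move=> ch mX mY mZ.
pose h' (p : 'rV[R]_(a + b) * 'rV[R]_c) := h (lsubmx p.1, rsubmx p.1, p.2).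
have ch' : continuous h'.
  move=> p; apply: (@continuous_comp _ _ _ (fun p : 'rV[R]_(a + b) * 'rV[R]_c =>
    (lsubmx p.1, rsubmx p.1, p.2)) h); last exact: ch.
  apply: continuous_pair; last by move=> ?; exact: cvg_snd.
  apply: continuous_pair => q; apply: (@continuous_comp _ _ _ fst).
  - exact: cvg_fst.
  - exact: continuous_lsubmx.
  - exact: cvg_fst.
  - exact: continuous_rsubmx.
have := continuous2_measurable ch' (measurable_row_mx mX mY) mZ.
by apply: eq_measurable_fun => t _ /=; rewrite /h' /= row_mxKl row_mxKr.
Qed.

Lemma measurable_rV_add d (T : measurableType d) n (X Y : T -> borel_rV R n) :
  measurable_fun setT X -> measurable_fun setT Y ->
  measurable_fun setT ((fun t => (X t + Y t : 'rV[R]_n)) : T -> borel_rV R n).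
Proof.
by move=> mX mY; exact: (continuous2_measurable (@add_continuous 'rV[R]_n) mX mY).
Qed.

Lemma measurable_rV_sub d (T : measurableType d) n (X Y : T -> borel_rV R n) :
  measurable_fun setT X -> measurable_fun setT Y ->
  measurable_fun setT ((fun t => (X t - Y t : 'rV[R]_n)) : T -> borel_rV R n).
Proof.
by move=> mX mY; exact: (continuous2_measurable (@sub_continuous 'rV[R]_n) mX mY).
Qed.

Lemma enorm_sqE n (x : 'rV[R]_n) : enorm x ^+ 2 = \sum_i x 0 i ^+ 2.
Proof. by rewrite sqr_sqrtr// sumr_ge0// => i _; exact: sqr_ge0. Qed.

Lemma enorm_continuous n : continuous (@enorm R n).
Proof.
have cs : continuous (fun x : 'rV[R]_n => \sum_i x 0 i ^+ 2).
  apply: continuous_big => [|i _ x]; first exact: add_continuous.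
  apply: (@continuous_comp _ _ _ (fun x : 'rV[R]_n => x 0 i) (fun r => r ^+ 2)).
    exact: coord_continuous.
  exact: exprn_continuous.
move=> x; apply: (@continuous_comp _ _ _ _ Num.sqrt); first exact: cs.
exact: sqrt_continuous.
Qed.

Lemma measurable_enorm n : measurable_fun setT (@enorm R n : borel_rV R n -> R).
Proof. by apply: continuous_measurable_real; exact: enorm_continuous. Qed.

Lemma enorm_coord n (x : 'rV[R]_n) i : `|x 0 i| <= enorm x.
Proof.
rewrite -(@ler_pXn2r _ 2)// ?nnegrE ?sqrtr_ge0// enorm_sqE real_normK ?num_real//.
by rewrite (bigD1 i)//= lerDl sumr_ge0// => j _; exact: sqr_ge0.
Qed.

Lemma enorm0 n : enorm (0 : 'rV[R]_n) = 0.
Proof. by rewrite /enorm big1 ?sqrtr0// => i _; rewrite mxE expr0n. Qed.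

End borel_row_vectors.

(** * Independence of the past *)

Section independent_noise.
Context d (T : measurableType d) (R : realType) (P : probability T R).
Context d' (E : measurableType d') (w : nat -> {RV P >-> E}).

(** The family of events generating [noise_filtration w k], named so that T can carry the generated
    sigma-algebra as a type. *)
Definition past_generator k : set (set T) :=
  \big[setU/set0]_(i < k) preimage_set_system setT (w i : T -> E) measurable.

Lemma past_generatorE k : past_generator k =
  \bigcup_(i < k) preimage_set_system setT (w i : T -> E) measurable.
Proof.
by rewrite (bigcup_mkord k (fun i => preimage_set_system setT (w i : T -> E) _)).
Qed.

(* T equipped with the sigma-algebra [noise_filtration w k], so that adaptedness
   is measurability on [past k]. *)
Definition past k := g_sigma_algebraType (past_generator k).

Lemma past_measurable d1 (E1 : measurableType d1) k (X : T -> E1) :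
  (forall B, measurable B -> noise_filtration w k (X @^-1` B)) <->
  measurable_fun setT (X : past k -> E1).
Proof.
split=> [h _ B mB|h B mB]; first by rewrite setTI; exact: h.
by have := h measurableT B mB; rewrite setTI.
Qed.

Lemma noise_past j k : (j < k)%N -> measurable_fun setT (w j : past k -> E).
Proof.
move=> jk _ B mB; rewrite setTI; apply: sub_sigma_algebra.
rewrite past_generatorE.
by exists j => //; exists B => //; rewrite setTI.
Qed.

Lemma past_le j k : (j <= k)%N -> past_generator j `<=` past_generator k.
Proof.
rewrite !past_generatorE => jk A [i ij iA].
by exists i => //=; exact: leq_trans ij jk.
Qed.

Lemma past_measurable_le d1 (E1 : measurableType d1) j k (X : T -> E1) :
  (j <= k)%N -> measurable_fun setT (X : past j -> E1) ->
  measurable_fun setT (X : past k -> E1).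
Proof.
move=> jk mX _ B mB; have := mX measurableT B mB.
apply: (@sub_smallest2r _ _ (past_generator j) (past_generator k)).
  exact: smallest_sigma_algebra.
exact: past_le.
Qed.

Lemma noise_filtration_measurable k : noise_filtration w k `<=` measurable.
Proof.
apply: smallest_sub; first exact: sigma_algebra_measurable.
rewrite -/(past_generator k) past_generatorE => A [i _ [B mB <-]].
exact: measurable_funP.
Qed.

(** Dynkin's pi-lambda argument: the cylinders [G] over the first [k] noises form a pi-system
    generating the past, and the events [H] independent of [C] form a lambda-system containing
    it. *)
Lemma noise_independent_of_past (w_indep : mutually_independent w) k A B :
  noise_filtration w k A -> measurable B ->
  P (A `&` w k @^-1` B) = (P A * P (w k @^-1` B))%E.
Proof.
move=> kA mB.
have mw i (C : set E) : measurable C -> measurable (w i @^-1` C).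
  by move=> mC; rewrite -[X in measurable X]setTI; exact: measurable_funP.
set C := w k @^-1` B; have mC : measurable C by exact: mw.
pose H := [set A | measurable A /\ P (A `&` C) = (P A * P C)%E].
pose J := fset_set `I_k.
have JE i : (i \in J) = (i < k)%N.
  by rewrite in_fset_set//; apply/idP/idP; rewrite inE.
pose G := [set A | exists2 D : nat -> set E, forall i, measurable (D i) &
  A = \bigcap_(i in [set` J]) (w i @^-1` D i)].
suff : <<s G>> `<=` H.
  move=> GH; apply: (proj2 (GH A _)).
  move: A kA; apply: smallest_sub; first exact: smallest_sigma_algebra.
  rewrite -/(past_generator k) past_generatorE.
  move=> _ [i /= ik [D mD <-]]; rewrite setTI; apply: sub_sigma_algebra.
  (* An event about [w i] alone is a cylinder with no constraint at the other indices. *)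
  exists (fun j => if j == i then D else setT) => [j|]; first by case: ifP.
  apply/seteqP; split=> t /=; first by move=> Dt j _; case: eqP => [->|].
  by move/(_ i); rewrite /= eqxx JE; apply.
apply: lambda_system_subset => //.
- move=> _ _ [D1 mD1 ->] [D2 mD2 ->]; exists (fun i => D1 i `&` D2 i).
    by move=> i; exact: measurableI.
  by rewrite -bigcapI; apply: eq_bigcapr => i _; rewrite preimage_setI.
- split=> //.
  + by split=> //; rewrite setTI probability_setT mul1e.
  + move=> X Y YX [mX XC] [mY YC]; split; first exact: measurableD.
    have fP Z : measurable Z -> P Z \is a fin_num.
      by move=> ?; exact: fin_num_measure.
    have PD U Z : measurable U -> measurable Z -> Z `<=` U ->
        P (U `\` Z) = (P U - P Z)%E.
      move=> mU mZ /setIidr ZU; rewrite -[in RHS]ZU; apply: measureD => //.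
      by rewrite -ge0_fin_numE// fP.
    rewrite (_ : (X `\` Y) `&` C = (X `&` C) `\` (Y `&` C)); last first.
      by apply/seteqP; split=> t /=; tauto.
    rewrite !PD//; [|exact: measurableI|exact: measurableI|exact: setSI].
    rewrite XC YC muleBl//; first exact: fP.
    by rewrite fin_num_adde_defl// fin_numN; exact: fP.
  (* Increasing unions: both sides of the product formula pass to the limit by continuity from
     below. *)
  + move=> F ndF HF; have mF i : measurable (F i) by case: (HF i).
    split; first exact: bigcupT_measurable.
    have mFC i : measurable (F i `&` C) by exact: measurableI.
    have c1 : P (F i `&` C) @[i --> \oo] --> P (\bigcup_i F i `&` C).
      rewrite setI_bigcupl; apply: nondecreasing_cvg_mu => //.
        exact: bigcupT_measurable.
      by move=> i j ij; apply/subsetPset; apply: setSI; exact/subsetPset/ndF.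
    have c2 : (P (F i) * P C)%E @[i --> \oo] --> (P (\bigcup_i F i) * P C)%E.
      apply: cvgeZr; first exact: fin_num_measure.
      by apply: nondecreasing_cvg_mu => //; exact: bigcupT_measurable.
    have FE : (fun i => P (F i `&` C)) = (fun i => P (F i) * P C)%E.
      by apply/funext => i; case: (HF i).
    by rewrite FE in c1; exact: (cvg_unique _ c1 c2).
- move=> _ [D mD ->]; split.
    by apply: fin_bigcap_measurable => // i _; exact: mw.
  (* Adding the constraint [B] at index [k] lets mutual independence over [J] and [k] split off the
     factor [P C]; independence over [J] then reassembles the cylinder. *)
  pose D' i := if i == k then B else D i.
  have mD' i : measurable (D' i) by rewrite /D'; case: ifP.
  have kJ : k \notin J by rewrite JE ltnn.
  have D'E i : i \in J -> D' i = D i.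
    by rewrite JE /D' => ik; rewrite lt_eqF.
  have D'k : D' k = B by rewrite /D' eqxx.
  have capE : \bigcap_(i in [set` J]) (w i @^-1` D' i) =
              \bigcap_(i in [set` J]) (w i @^-1` D i).
    by apply: eq_bigcapr => i /D'E ->.
  have prodE : (\prod_(i <- J) P (w i @^-1` D' i) =
                \prod_(i <- J) P (w i @^-1` D i))%E.
    by apply: eq_big_seq => i /D'E ->.
  have := w_indep (k |` J)%fset _ mD'.
  rewrite bigcap_fsetU1 big_fsetU1//= D'k -/C capE prodE setIC => ->.
  by rewrite muleC (w_indep J _ mD).
Qed.

End independent_noise.

(** * Integrating out the current noise with the past frozen *)

Section freezing.
Context d (T : measurableType d) (R : realType) (P : probability T R).
Context d' (E : measurableType d') (w : nat -> {RV P >-> E}).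
Hypotheses (w_indep : mutually_independent w) (w_ident : identically_distributed w).

Lemma past_measurable_fun d1 (E1 : measurableType d1) k (X : T -> E1) :
  measurable_fun setT (X : past w k -> E1) -> measurable_fun setT X.
Proof.
move=> /past_measurable mX _ B mB; rewrite setTI.
by apply: (@noise_filtration_measurable _ _ _ _ _ _ w k); exact: mX.
Qed.

(** Independence makes the joint law of [X] and [w k] the product of their laws, so Tonelli
    integrates the noise first; identical distribution then replaces [w k] by [w 0]. *)
Lemma integral_freezing d1 (E1 : measurableType d1) k (X : T -> E1)
    (h : E1 * E -> \bar R) :
  measurable_fun setT (X : past w k -> E1) -> measurable_fun setT h ->
  (forall p, 0 <= h p)%E ->
  (\int[P]_t h (X t, w k t) = \int[P]_t \int[P]_s h (X t, w 0%N s))%E.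
Proof.
move=> pX mh h0; have mX := past_measurable_fun pX.
pose X' : {RV P >-> E1} := HB.pack X (isMeasurableFun.Build _ _ _ _ X mX).
have mXw : measurable_fun setT (fun t => (X t, w k t)).
  exact: measurable_fun_pair.
pose Xw : {RV P >-> (E1 * E)%type} :=
  HB.pack (fun t => (X t, w k t)) (isMeasurableFun.Build _ _ _ _ _ mXw).
transitivity (\int[distribution P Xw]_p h p)%E.
  by rewrite ge0_integral_distribution.
transitivity (\int[distribution P X' \x distribution P (w k)]_p h p)%E.
  (* The product measure is determined by rectangles, where the claim is exactly independence from
     the past. *)
  apply: eq_measure_integral => A mA _; apply/esym/product_measure_unique => // B C mB mC.
  exact: (noise_independent_of_past w_indep ((past_measurable w k X).2 pX B mB) mC).
rewrite fubini_tonelli1//=.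
rewrite ge0_integral_distribution//=; last 2 first.
- exact: measurable_fun_fubini_tonelli_F.
- by move=> x; exact: integral_ge0.
apply: eq_integral => t _; rewrite /fubini_F/=.
transitivity (\int[distribution P (w 0%N)]_y h (X t, y))%E.
  by apply: eq_measure_integral => A mA _; exact: w_ident.
rewrite ge0_integral_distribution//.
exact: measurableT_comp.
Qed.

End freezing.

(** * Dissipation inequalities *)

Section dissipation.
Context d (T : measurableType d) (R : realType) (P : probability T R).
Context (N nw nv : nat) (w : nat -> {RV P >-> borel_rV R nw}).
Hypotheses (w_indep : mutually_independent w) (w_ident : identically_distributed w).
Variable F : 'rV[R]_N -> 'rV[R]_nw -> 'rV[R]_nv -> 'rV[R]_N.
Hypothesis F_meas : measurable_fun setT
  ((fun p => F p.1.1 p.1.2 p.2) :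
     borel_rV R N * borel_rV R nw * borel_rV R nv -> borel_rV R N).
Variable v : nat -> T -> 'rV[R]_nv.
Hypothesis v_adapted : adapted (noise_filtration w) v.
Variable eta0 : 'rV[R]_N.
Let eta := trajectory w F v eta0.

Lemma adapted_past k : measurable_fun setT (v k : past w k -> borel_rV R nv).
Proof. by apply/past_measurable => B; exact: v_adapted. Qed.

Lemma trajectory_past k : measurable_fun setT (eta k : past w k -> borel_rV R N).
Proof.
elim: k => [|k IH]; first exact: measurable_cst.
have mk d1 (E1 : measurableType d1) (X : T -> E1) :
    measurable_fun setT (X : past w k -> E1) ->
    measurable_fun setT (X : past w k.+1 -> E1).
  exact: past_measurable_le.
have mew := measurable_fun_pair (mk _ _ _ IH) (noise_past (ltnSn k)).
exact: measurableT_comp F_meas (measurable_fun_pair mew (mk _ _ _ (@adapted_past k))).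
Qed.

Lemma trajectory_measurable k : measurable_fun setT (eta k : T -> borel_rV R N).
Proof. exact: past_measurable_fun (@trajectory_past k). Qed.

Lemma adapted_measurable k : measurable_fun setT (v k : T -> borel_rV R nv).
Proof. exact: past_measurable_fun (@adapted_past k). Qed.

Variables (U : 'rV[R]_N -> R) (q : 'rV[R]_N -> 'rV[R]_nv -> R)
  (c : 'rV[R]_nv -> R).
Hypotheses (U_ge0 : forall x, 0 <= U x) (q_ge0 : forall x u, 0 <= q x u)
  (c_ge0 : forall u, 0 <= c u).
Hypotheses (U_meas : measurable_fun setT (U : borel_rV R N -> R))
  (q_meas : measurable_fun setT
     ((fun p => q p.1 p.2) : borel_rV R N * borel_rV R nv -> R))
  (c_meas : measurable_fun setT (c : borel_rV R nv -> R)).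
Hypothesis dissip : forall x u,
  (\int[P]_s (U (F x (w 0%N s) u))%:E + (q x u)%:E <= (U x)%:E + (c u)%:E)%E.

(** Freezing the pair of [eta k] and [v k] turns the first integral into the average of the left
    side of [dissip] at that pair; [dissip] is then integrated pointwise. *)
Lemma dissipation_step k :
  (\int[P]_t (U (eta k.+1 t))%:E + \int[P]_t (q (eta k t) (v k t))%:E <=
   \int[P]_t (U (eta k t))%:E + \int[P]_t (c (v k t))%:E)%E.
Proof.
have me := @trajectory_measurable k; have mv := @adapted_measurable k.
have mUe : measurable_fun setT (fun t => (U (eta k t))%:E).
  by apply/measurable_EFinP; exact: measurableT_comp U_meas me.
have mcv : measurable_fun setT (fun t => (c (v k t))%:E).
  by apply/measurable_EFinP; exact: measurableT_comp c_meas mv.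
have mqv : measurable_fun setT (fun t => (q (eta k t) (v k t))%:E).
  by apply/measurable_EFinP; exact: measurableT_comp q_meas (measurable_fun_pair me mv).
pose h (p : borel_rV R N * borel_rV R nv * borel_rV R nw) :=
  (U (F p.1.1 p.2 p.1.2))%:E.
have mh : measurable_fun setT h.
  apply/measurable_EFinP; apply: (measurableT_comp U_meas).
  have mx := measurableT_comp (@measurable_fst _ _ (borel_rV R N) (borel_rV R nv))
    (@measurable_fst _ _ _ (borel_rV R nw)).
  have mu := measurableT_comp (@measurable_snd _ _ (borel_rV R N) (borel_rV R nv))
    (@measurable_fst _ _ _ (borel_rV R nw)).
  exact: measurableT_comp F_meas
    (measurable_fun_pair (measurable_fun_pair mx measurable_snd) mu).
have h0 p : (0 <= h p)%E by rewrite lee_fin.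
have := integral_freezing w_indep w_ident
  (measurable_fun_pair (@trajectory_past k) (@adapted_past k)) mh h0.
rewrite /h/= => ->.
(* The inner integral is a Tonelli section for the law of [w 0], composed with the state and
   disturbance. *)
have mI : measurable_fun setT
    (fun t => \int[P]_s (U (F (eta k t) (w 0%N s) (v k t)))%:E)%E.
  have mf := measurable_fun_fubini_tonelli_F (m2 := distribution P (w 0%N)) h mh h0.
  have := measurableT_comp mf (measurable_fun_pair me mv).
  apply: eq_measurable_fun => t _ /=; rewrite /fubini_F ge0_integral_distribution//.
  exact: measurableT_comp.
rewrite -ge0_integralD//=; last 2 first.
- by move=> t _; apply: integral_ge0 => s _; rewrite lee_fin.
- by move=> t _; rewrite lee_fin.
rewrite -ge0_integralD//=; last 2 first.
- by move=> t _; rewrite lee_fin.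
- by move=> t _; rewrite lee_fin.
apply: ge0_le_integral => //=.
- move=> t _; apply: adde_ge0; last by rewrite lee_fin.
  by apply: integral_ge0 => s _; rewrite lee_fin.
- exact: emeasurable_funD.
- exact: emeasurable_funD.
Qed.

(** Telescoping by induction in additive form: the integrals may be infinite, so nothing is
    subtracted. *)
Lemma dissipation_sum n :
  (\int[P]_t (U (eta n t))%:E + \sum_(0 <= k < n) \int[P]_t (q (eta k t) (v k t))%:E <=
   (U eta0)%:E + \sum_(0 <= k < n) \int[P]_t (c (v k t))%:E)%E.
Proof.
elim: n => [|n IH].
  by rewrite !big_geq// !adde0 /eta/= integral_cst//= probability_setT mule1.
rewrite !big_nat_recr//=.
rewrite [X in (_ + X)%E]addeC addeA; apply: le_trans (leeD (@dissipation_step n) (lexx _)) _.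
by rewrite addeAC [leRHS]addeA leeD.
Qed.

Lemma dissipation_series :
  (\sum_(0 <= k <oo) \int[P]_t (q (eta k t) (v k t))%:E <=
   (U eta0)%:E + \sum_(0 <= k <oo) \int[P]_t (c (v k t))%:E)%E.
Proof.
have I0 (f : T -> R) : (forall t, 0 <= f t) -> (0 <= \int[P]_t (f t)%:E)%E.
  by move=> f0; apply: integral_ge0 => t _; rewrite lee_fin.
apply: lime_le; first by apply: is_cvg_nneseries => *; apply: I0.
apply: nearW => n.
apply: (@le_trans _ _ (\int[P]_t (U (eta n t))%:E +
    \sum_(0 <= k < n) \int[P]_t (q (eta k t) (v k t))%:E)%E).
  by rewrite leeDr// I0.
apply: le_trans (dissipation_sum n) _; apply: leeD => //.
by apply: nneseries_lim_ge => *; apply: I0.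
Qed.

End dissipation.

(** * Positive radially unbounded functions *)

Section radially_unbounded.
Context (R : realType) (n : nat).

(** Far away [U] is at least 1 by radial unboundedness; on the remaining closed shell, which is
    compact, continuity and positivity keep [U] away from 0. *)
Lemma pru_lower_bound (U : 'rV[R]_n -> R) e :
  positive_radially_unbounded U -> 0 < e ->
  exists2 c, 0 < c & forall x, e <= enorm x -> c <= U x.
Proof.
move=> [Uc U0 Upos Uoo] e0.
have [r rU] : exists r, forall x, r < enorm x -> 1 <= U x.
  move: Uoo; rewrite limf_einfE => Uoo.
  have /ereal_sup_gt[_ [A [r _ rA] <-]] : (1%:E < ereal_sup
      [set ereal_inf ((fun x => (U x)%:E) @` A) | A in enorm_infty (n := n)])%E.
    by rewrite Uoo ltry.
  move=> h; exists r => x /rA Ax; rewrite -lee_fin (le_trans (ltW h))//.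
  by apply: ereal_inf_lbound; exists x.
pose K := [set x : 'rV[R]_n | e <= enorm x <= r].
have cK : compact K.
  have cB : compact [set x : 'rV[R]_n | forall i, `[- r, r]%classic (x ord0 i)].
    apply: (@rV_compact _ _ (fun=> `[- r, r]%classic)) => i.
    exact: segment_compact.
  apply: subclosed_compact cB _; last first.
    move=> x /andP[_ xr] i; rewrite /= in_itv/= -ler_norml.
    exact: le_trans (enorm_coord x i) xr.
  rewrite (_ : K = @enorm R n @^-1` `[e, r]%classic); last first.
    by apply/seteqP; split=> x; rewrite /K/= in_itv.
  by apply: closed_comp => [x _|]; [exact: enorm_continuous|exact: interval_closed].
have cUK : compact (U @` K).
  by apply: continuous_compact => //; exact: continuous_subspaceT.
(* The compact image of the shell is closed and omits 0, so a whole neighbourhood of 0 misses it;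
   this also covers an empty shell. *)
have nUK : nbhs 0 (~` (U @` K)).
  apply: open_nbhs_nbhs; split.
    by apply: closed_openC; apply: compact_closed => //; exact: norm_hausdorff.
  move=> [x /andP[ex _] Ux]; have : 0 < U x.
    apply: Upos; apply/eqP => x0; move: ex.
    by rewrite x0 enorm0 leNgt e0.
  by rewrite Ux ltxx.
have /nbhs_ballP[c /= c0 cUK'] := nUK.
exists (Num.min 1 c); first by rewrite lt_min ltr01.
move=> x ex; have [xr|rx] := leP (enorm x) r; last by rewrite ge_min rU.
have Ux0 : 0 < U x.
  by apply: Upos; apply/eqP => x0; move: ex; rewrite x0 enorm0 leNgt e0.
rewrite ge_min; apply/orP; right; rewrite leNgt; apply/negP => Uxc.
apply: (cUK' (U x)); last by exists x => //; rewrite /K/= ex.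
by rewrite /ball/= sub0r normrN gtr0_norm.
Qed.

Lemma pru_ge0 (U : 'rV[R]_n -> R) : positive_radially_unbounded U -> forall x, 0 <= U x.
Proof.
move=> [_ U0 Upos _] x; have [->|/Upos/ltW//] := eqVneq x 0.
by rewrite U0.
Qed.

(** Once [U (x k)] drops below the lower bound of [U] outside the ball of radius [e], the point
    [x k] must lie inside it. *)
Lemma pru_cvg0 (U : 'rV[R]_n -> R) (x : nat -> 'rV[R]_n) :
  positive_radially_unbounded U -> U (x k) @[k --> \oo] --> 0 ->
  x k @[k --> \oo] --> (0 : 'rV[R]_n).
Proof.
move=> Upru Ux; apply/cvg_ballP => e e0.
have [c c0 cU] := pru_lower_bound Upru e0.
have : \forall k \near \oo, U (x k) < c by exact: (cvgr_lt 0).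
apply: filterS => k Uk; split => // i j; rewrite ord1 mxE /ball/= sub0r normrN.
apply: le_lt_trans (enorm_coord _ _) _; rewrite ltNge; apply/negP => /cU.
by rewrite leNgt Uk.
Qed.

End radially_unbounded.

(** * Maximal inequality for the undisturbed system *)

Section internal_stability.
Context d (T : measurableType d) (R : realType) (P : probability T R).
Context (N nw nv : nat) (w : nat -> {RV P >-> borel_rV R nw}).
Hypotheses (w_indep : mutually_independent w) (w_ident : identically_distributed w).
Variable F : 'rV[R]_N -> 'rV[R]_nw -> 'rV[R]_nv -> 'rV[R]_N.
Hypothesis F_meas : measurable_fun setT
  ((fun p => F p.1.1 p.1.2 p.2) :
     borel_rV R N * borel_rV R nw * borel_rV R nv -> borel_rV R N).

Lemma adapted_cst (u : 'rV[R]_nv) : adapted (noise_filtration w) (fun _ _ => u).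
Proof. by move=> k; apply/past_measurable; exact: measurable_cst. Qed.

Let eta := trajectory w F (fun _ _ => 0).

Lemma maximal_inequality (U : 'rV[R]_N -> R) (e c : R) (eta0 : 'rV[R]_N) :
  (forall x, 0 <= U x) -> measurable_fun setT (U : borel_rV R N -> R) ->
  (forall x, \int[P]_s (U (F x (w 0%N s) 0))%:E <= (U x)%:E)%E ->
  0 < c -> (forall x, e <= enorm x -> c <= U x) ->
  (c%:E * P [set t | e%:E <
      ereal_sup [set (enorm (eta eta0 k t))%:E | k in setT]] <= (U eta0)%:E)%E.
Proof.
move=> U_ge0 U_meas U_dec c0 cU.
(* The dynamics frozen on leaving the ball of radius e: its trajectory xi lies
   outside the ball at time k iff eta has left it by time k. *)
pose G x s (u : 'rV[R]_nv) := if e < enorm x then x else F x s 0.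
have m1 : measurable_fun setT
    ((fun p => p.1.1) : borel_rV R N * borel_rV R nw * borel_rV R nv -> borel_rV R N).
  exact: measurableT_comp.
have m2 : measurable_fun setT
    ((fun p => p.1.2) : borel_rV R N * borel_rV R nw * borel_rV R nv -> borel_rV R nw).
  exact: measurableT_comp.
have G_meas : measurable_fun setT
    ((fun p => G p.1.1 p.1.2 p.2) :
     borel_rV R N * borel_rV R nw * borel_rV R nv -> borel_rV R N).
  apply: measurable_fun_ifT => //.
    apply: measurable_fun_ltr => //.
    exact: measurableT_comp (@measurable_enorm _ _) m1.
  exact: measurableT_comp F_meas
    (measurable_fun_pair (measurable_fun_pair m1 m2) (measurable_cst (0 : borel_rV R nv))).
have G_dec x u : (\int[P]_s (U (G x (w 0%N s) u))%:E + 0%:E <= (U x)%:E + 0%:E)%E.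
  rewrite !adde0 /G; case: (e < enorm x) => //.
  by rewrite integral_cst// [X in (_ * X)%E]probability_setT mule1.
pose xi := trajectory w G (fun _ _ => 0) eta0.
have mxi k : measurable_fun setT (xi k : T -> borel_rV R N).
  exact: (trajectory_measurable G_meas (adapted_cst 0)).
have meta k : measurable_fun setT (eta eta0 k : T -> borel_rV R N).
  exact: (trajectory_measurable F_meas (adapted_cst 0)).
pose A k := [set t | e < enorm (xi k t)].
have menorm (X : T -> 'rV[R]_N) : measurable_fun setT (X : T -> borel_rV R N) ->
    measurable [set t | e < enorm (X t)].
  move=> mX; rewrite (_ : mkset _ = (@enorm R N \o X) @^-1` `]e, +oo[%classic).
    rewrite -[X in measurable X]setTI.
    exact: (measurableT_comp (@measurable_enorm _ _) mX).
  by apply/seteqP; split=> t /=; rewrite in_itv/= andbT.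
have mA k : measurable (A k) by exact: menorm.
have AS k : A k `<=` A k.+1 by move=> t At; rewrite /A/= /xi/= /G ifT.
have xiE k t : ~ A k t -> xi k t = eta eta0 k t.
  elim: k => // k IH nA; have nAk : ~ A k t by move/AS.
  rewrite (_ : xi k.+1 t = G (xi k t) (w k t) 0)// /G ifF; first by rewrite IH.
  exact/negbTE/negP.
have SE : [set t | e%:E < ereal_sup [set (enorm (eta eta0 k t))%:E | k in setT]]%E =
    \bigcup_k [set t | e < enorm (eta eta0 k t)].
  apply/seteqP; split=> t /=.
    by move=> /ereal_sup_gt[_ [k _ <-]]; rewrite lte_fin => ?; exists k.
  move=> [k _ /= ek]; apply: lt_le_trans (_ : (enorm (eta eta0 k t))%:E <= _)%E.
    by rewrite lte_fin.
  by apply: ereal_sup_ubound; exists k.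
have PA k : (c%:E * P (A k) <= (U eta0)%:E)%E.
  have mU : measurable_fun setT (fun t => (U (xi k t))%:E).
    by apply/measurable_EFinP; exact: measurableT_comp U_meas (mxi k).
  have := @dissipation_sum _ _ _ _ _ _ _ w w_indep w_ident G G_meas _
    (adapted_cst 0) eta0 U (fun _ _ => 0) (fun _ => 0) U_ge0
    (fun _ _ => lexx 0) (fun _ => lexx 0) U_meas (measurable_cst _)
    (measurable_cst _) G_dec k.
  rewrite !big1 ?adde0; last by move=> *; exact: integral0.
  apply: le_trans; rewrite -/xi.
  (* Markov's inequality for [U (xi k)], whose mean is at most [U eta0]; on [A k] its value is at
     least [c]. *)
  have := le_integral_abse P measurableT mU c0.
  under [X in (_ <= X)%E -> _]eq_integral do rewrite gee0_abs ?lee_fin//.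
  apply: le_trans; rewrite lee_pmul2l ?lte_fin// setTI.
  apply: le_measure; rewrite ?inE//.
    rewrite -[X in measurable X]setTI; apply: emeasurable_fun_c_infty => //.
    exact: measurableT_comp.
  by move=> t /ltW/cU ct /=; rewrite ger0_norm// lee_fin.
have mS : measurable (\bigcup_k [set t | e < enorm (eta eta0 k t)]).
  by apply: bigcupT_measurable => k; exact: menorm.
have mUA : measurable (\bigcup_k A k) by exact: bigcupT_measurable.
(* The exit event lies in the union of the [A k]: before freezing, [xi] and [eta] coincide. As the
   [A k] increase, the uniform bound on them passes to the union. *)
rewrite SE; apply: (@le_trans _ _ (c%:E * P (\bigcup_k A k))%E).
  rewrite lee_pmul2l ?lte_fin//; apply: le_measure; rewrite ?inE//.
  move=> t [k _ /= ek]; have [?|/xiE xik] := pselect (A k t); first by exists k.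
  by exists k => //; rewrite /A/= xik.
have ndA : {homo A : i j / (i <= j)%N >-> (i <= j)%O}.
  by apply/nondecreasing_seqP => k; apply/subsetPset; exact: AS.
have Pc : (c%:E * P (A k))%E @[k --> \oo] --> (c%:E * P (\bigcup_k A k))%E.
  by apply: cvgeZl => //; exact: nondecreasing_cvg_mu.
by apply: (cvge_le _ Pc); exact: nearW.
Qed.

End internal_stability.

(** * The filter *)

(** Exchanging sum and integral shows that the pointwise series has finite integral; it is then
    finite almost everywhere, and terms of a convergent series tend to 0. *)
Lemma ae_cvg0_of_summable_integral d (T : measurableType d) (R : realType)
    (mu : {measure set T -> \bar R}) (b : nat -> T -> R) :
  (forall k, measurable_fun setT (b k)) -> (forall k t, 0 <= b k t) ->
  (\sum_(0 <= k <oo) \int[mu]_t (b k t)%:E < +oo)%E ->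
  mu.-negligible (~` [set t | b k t @[k --> \oo] --> (0 : R)]).
Proof.
move=> mb b0 boo.
have mEb k : measurable_fun setT (fun t => (b k t)%:E) by exact/measurable_EFinP.
have ms : measurable_fun setT (fun t => \sum_(0 <= k <oo) (b k t)%:E)%E.
  by apply: (@ge0_emeasurable_sum _ _ _ _ _ xpredT) => // k t _ _; rewrite lee_fin.
have s0 t : (0 <= \sum_(0 <= k <oo) (b k t)%:E)%E.
  by apply: nneseries_ge0 => k _ _; rewrite lee_fin.
have /integrable_ae : mu.-integrable setT (fun t => \sum_(0 <= k <oo) (b k t)%:E)%E.
  apply/integrableP; split => //.
  under eq_integral do rewrite gee0_abs//.
  by rewrite integral_nneseries// => k t _; rewrite lee_fin.
move=> /(_ measurableT) sfin; apply: negligibleS sfin => t /= ncvg fint; apply: ncvg.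
apply: cvg_series_cvg_0; apply: nnseries_is_cvg => //.
by rewrite -ge0_fin_numE//; exact: fint.
Qed.

(** * Measurability of the augmented dynamics and output *)

Section augmented_measurability.
Context (R : realType) (n nh nw nv ny nz : nat).
Variables (f : 'rV[R]_n -> 'rV[R]_nw -> 'rV[R]_nv -> 'rV[R]_n)
  (g : 'rV[R]_n -> 'rV[R]_nv -> 'rV[R]_ny)
  (m : 'rV[R]_n -> 'rV[R]_nv -> 'rV[R]_nz).
Hypotheses (f_cont : continuous
       (fun p : 'rV[R]_n * 'rV[R]_nw * 'rV[R]_nv => f p.1.1 p.1.2 p.2))
  (g_cont : continuous (fun p : 'rV[R]_n * 'rV[R]_nv => g p.1 p.2))
  (m_cont : continuous (fun p : 'rV[R]_n * 'rV[R]_nv => m p.1 p.2)).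
Variables (fh : 'rV[R]_nh -> 'rV[R]_nh) (gh : 'rV[R]_ny -> 'rV[R]_nh)
  (mh : 'rV[R]_nh -> 'rV[R]_nz).
Hypotheses (fh_meas : measurable_fun setT (fh : borel_rV R nh -> borel_rV R nh))
  (gh_meas : measurable_fun setT (gh : borel_rV R ny -> borel_rV R nh))
  (mh_meas : measurable_fun setT (mh : borel_rV R nh -> borel_rV R nz)).

Lemma aug_dynamics_measurable : measurable_fun setT
  ((fun p => aug_dynamics f g fh gh p.1.1 p.1.2 p.2) :
   borel_rV R (n + nh) * borel_rV R nw * borel_rV R nv -> borel_rV R (n + nh)).
Proof.
pose S := (borel_rV R (n + nh) * borel_rV R nw * borel_rV R nv)%type.
have m1 : measurable_fun setT ((fun p => p.1.1) : S -> borel_rV R (n + nh)).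
  exact: measurableT_comp.
have m2 : measurable_fun setT ((fun p => p.1.2) : S -> borel_rV R nw).
  exact: measurableT_comp.
have m3 : measurable_fun setT ((fun p => p.2) : S -> borel_rV R nv).
  exact: measurable_snd.
have mx := measurableT_comp (@measurable_lsubmx R n nh) m1.
have mxh := measurableT_comp (@measurable_rsubmx R n nh) m1.
apply: measurable_row_mx.
  exact: (continuous3_measurable f_cont mx m2 m3).
apply: measurable_rV_add; first exact: measurableT_comp fh_meas mxh.
exact: measurableT_comp gh_meas (continuous2_measurable g_cont mx m3).
Qed.

Lemma aug_output_measurable : measurable_fun setT
  ((fun p => enorm (aug_output m mh p.1 p.2) ^+ 2) :
   borel_rV R (n + nh) * borel_rV R nv -> R).
Proof.
pose S := (borel_rV R (n + nh) * borel_rV R nv)%type.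
have m1 : measurable_fun setT (fst : S -> borel_rV R (n + nh)).
  exact: measurable_fst.
have m2 : measurable_fun setT (snd : S -> borel_rV R nv).
  exact: measurable_snd.
have mx := measurableT_comp (@measurable_lsubmx R n nh) m1.
have mxh := measurableT_comp (@measurable_rsubmx R n nh) m1.
apply: measurable_funX; apply: (measurableT_comp (@measurable_enorm R nz)).
apply: measurable_rV_sub; last exact: measurableT_comp mh_meas mxh.
exact: (continuous2_measurable m_cont mx m2).
Qed.

End augmented_measurability.

Theorem corollary2 (R : realType) (d : measure_display) (T : measurableType d)
    (P : probability T R) (P_complete : measure_is_complete P)
    (n nh nw nv ny nz : nat)
    (w : nat -> {RV P >-> borel_rV R nw})
    (w_indep : mutually_independent w) (w_ident : identically_distributed w)
    (f : 'rV[R]_n -> 'rV[R]_nw -> 'rV[R]_nv -> 'rV[R]_n)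
    (g : 'rV[R]_n -> 'rV[R]_nv -> 'rV[R]_ny)
    (m : 'rV[R]_n -> 'rV[R]_nv -> 'rV[R]_nz)
    (f_cont : continuous
       (fun p : 'rV[R]_n * 'rV[R]_nw * 'rV[R]_nv => f p.1.1 p.1.2 p.2))
    (g_cont : continuous (fun p : 'rV[R]_n * 'rV[R]_nv => g p.1 p.2))
    (m_cont : continuous (fun p : 'rV[R]_n * 'rV[R]_nv => m p.1 p.2))
    (f0 : f 0 0 0 = 0) (g0 : g 0 0 = 0) (m0 : m 0 0 = 0)
    (fh : 'rV[R]_nh -> 'rV[R]_nh) (gh : 'rV[R]_ny -> 'rV[R]_nh)
    (mh : 'rV[R]_nh -> 'rV[R]_nz)
    (fh_meas : measurable_fun setT (fh : borel_rV R nh -> borel_rV R nh))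
    (gh_meas : measurable_fun setT (gh : borel_rV R ny -> borel_rV R nh))
    (mh_meas : measurable_fun setT (mh : borel_rV R nh -> borel_rV R nz))
    (fh0 : fh 0 = 0) (gh0 : gh 0 = 0) (mh0 : mh 0 = 0)
    (gamma : R) (gamma_gt0 : 0 < gamma)
    (V W : 'rV[R]_(n + nh) -> R)
    (V_pru : positive_radially_unbounded V)
    (W_pru : positive_radially_unbounded W)
    (W_le : forall eta : 'rV[R]_(n + nh),
       W eta <= enorm (aug_output m mh eta (0 : 'rV[R]_nv)) ^+ 2)
    (V_dissip : forall (eta : 'rV[R]_(n + nh)) (v : 'rV[R]_nv),
       ('E_P[fun t => V (aug_dynamics f g fh gh eta (w 0%N t) v)]
          - (V eta)%:E + (enorm (aug_output m mh eta v) ^+ 2)%:E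
          - (gamma ^+ 2 * enorm v ^+ 2)%:E <= 0)%E) :
  internally_stable w (aug_dynamics f g fh gh) /\
  externally_stable w (aug_dynamics f g fh gh) (aug_output m mh) gamma.
Proof.
set F := aug_dynamics f g fh gh.
pose q eta (v : 'rV[R]_nv) := enorm (aug_output m mh eta v) ^+ 2.
pose c (v : 'rV[R]_nv) := gamma ^+ 2 * enorm v ^+ 2.
have F_meas := aug_dynamics_measurable f_cont g_cont fh_meas gh_meas.
have q_meas := aug_output_measurable m_cont mh_meas.
have [Vc V0 _ _] := V_pru.
have V_meas : measurable_fun setT (V : borel_rV R (n + nh) -> R).
  exact: continuous_measurable_real.
have sq_meas : measurable_fun setT ((fun v => enorm v ^+ 2) : borel_rV R nv -> R).
  by apply: measurable_funX; exact: measurable_enorm.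
have c_meas : measurable_fun setT (c : borel_rV R nv -> R).
  exact: measurable_funM.
have q_ge0 eta v : 0 <= q eta v by exact: sqr_ge0.
have c_ge0 v : 0 <= c v by rewrite mulr_ge0 ?sqr_ge0.
have V_ge0 := pru_ge0 V_pru.
have dissip x u : (\int[P]_s (V (F x (w 0%N s) u))%:E + (q x u)%:E <=
                   (V x)%:E + (c u)%:E)%E.
  have := V_dissip x u; rewrite unlock -/F -/(q x u) -/(c u).
  (* Moving terms across is legitimate for a finite integral only; the value [+oo] contradicts
     [V_dissip], and [-oo] makes the goal trivial. *)
  case: (\int[P]_s (V (F x (w 0%N s) u))%:E)%E => [r| |] //=; last by move=> _; rewrite leNye.
  by rewrite -!EFinD !lee_fin; lra.
have total v eta0 (v_ad : adapted (noise_filtration w) v) :=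
  dissipation_series w_indep w_ident F_meas v_ad eta0 V_ge0 q_ge0 c_ge0
    V_meas q_meas c_meas dissip.
have c00 : c 0 = 0 by rewrite /c enorm0 expr0n mulr0.
have v0_ad := @adapted_cst _ _ _ P nw nv w 0.
split; [split=> [e e0|eta0]|].
- have [b b0 bV] := pru_lower_bound V_pru e0.
  have V_dec x : (\int[P]_s (V (F x (w 0%N s) 0))%:E <= (V x)%:E)%E.
    have := dissip x 0; rewrite c00 adde0; apply: le_trans.
    by rewrite leeDl// lee_fin.
  have Pb x := maximal_inequality w_indep w_ident F_meas x V_ge0 V_meas V_dec b0 bV.
  (* The exit probability is squeezed between 0 and [V x / b], which tends to 0 because [V] is
     continuous and vanishes at 0. *)
  have PV x : (0 <= P [set t | e%:E <
      ereal_sup [set (enorm (trajectory w F (fun=> cst 0) x k t))%:E | k in setT]]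
      <= (b^-1 * V x)%:E)%E.
    by rewrite measure_ge0/= EFinM lee_pdivlMl//; exact: Pb.
  have N0 : Filter (nbhs (0 : 'rV[R]_(n + nh))) := nbhs_filter _.
  have PV0 := @filterE _ _ N0 _ PV.
  have bV0 : (b^-1 * V x)%:E @[x --> (0 : 'rV[R]_(n + nh))] --> 0%E.
    apply: cvg_EFin; first exact: filterE.
    rewrite -[X in _ --> X](_ : b^-1 * V 0 = 0); last by rewrite V0 mulr0.
    exact: (cvgM (cvg_cst _) (Vc 0)).
  have c0E : (fun=> 0%E : \bar R) x @[x --> (0 : 'rV[R]_(n + nh))] --> 0%E.
    exact: cvg_cst.
  have cP := squeeze_cvge PV0 c0E bV0.
  (* The limit over full neighbourhoods of 0 restricts to punctured ones. *)
  by move=> A /cP; apply: (@filterS _ _ N0) => x Ax _; exact: Ax.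
- have := total _ eta0 v0_ad; rewrite c00.
  set eta := trajectory _ _ _ _ => bound.
  have := @ae_cvg0_of_summable_integral _ _ _ P (fun k t => q (eta k t) 0).
  have mq k : measurable_fun setT (fun t => q (eta k t) 0).
    apply: measurableT_comp q_meas (measurable_fun_pair _ (measurable_cst _)).
    exact: (trajectory_measurable F_meas v0_ad).
  move=> /(_ mq) /(_ ltac:(by [])).
  (* Without disturbance the supply vanishes, leaving the finite bound [V eta0]. *)
  have bnd : (\sum_(0 <= k <oo) \int[P]_t (q (eta k t) 0)%:E < +oo)%E.
    apply: le_lt_trans bound _; rewrite eseries0 ?adde0 ?ltry//.
    by move=> *; exact: integral0.
  move=> /(_ bnd) neg.
  have negC : P.-negligible (~` [set t | eta k t @[k --> \oo] --> (0 : 'rV[R]_(n + nh))]).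
    apply: negligibleS neg => t /= neta qt0; apply: neta.
    (* The output energy tends to 0 and dominates [W], so the state follows it to 0. *)
    have Wq k : 0 <= W (eta k t) <= q (eta k t) 0.
      by rewrite (pru_ge0 W_pru) W_le.
    have c0k : (fun=> 0 : R) k @[k --> \oo] --> (0 : R) by exact: cvg_cst.
    exact/(pru_cvg0 W_pru)/(squeeze_cvgr (nearW _ Wq) c0k qt0).
  (* Completeness makes the negligible set of non-convergence an event. *)
  have mC := P_complete _ negC.
  have PC := measure_negligible mC negC.
  rewrite -[X in P X]setCK probability_setC// [X in (_ - X)%E]PC sube0//.
- move=> v [v_ad v_oo] _.
  (* From the zero state no energy is stored initially, so the summed inequality is the gain bound
     up to exchanging sums with integrals and extracting [gamma ^+ 2]. *)
  have := total _ 0 v_ad; rewrite V0 add0e.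
  have mv k : measurable_fun setT (v k : T -> borel_rV R nv).
    exact: (adapted_measurable v_ad).
  have mt k : measurable_fun setT
      (trajectory w F v 0 k : T -> borel_rV R (n + nh)).
    exact: (trajectory_measurable F_meas v_ad).
  have msv k : measurable_fun setT (fun t => (enorm (v k t) ^+ 2)%:E).
    by apply/measurable_EFinP; exact: measurableT_comp sq_meas (mv k).
  have mqv k : measurable_fun setT (fun t => (q (trajectory w F v 0 k t) (v k t))%:E).
    apply/measurable_EFinP.
    exact: measurableT_comp q_meas (measurable_fun_pair (mt k) (mv k)).
  rewrite /l2_sqnorm integral_nneseries//; last by move=> *; rewrite lee_fin sqr_ge0.
  move=> h; apply: le_trans h _.
  rewrite integral_nneseries//; last by move=> *; rewrite lee_fin sqr_ge0.
  rewrite -nneseriesZl; last by move=> *; apply: integral_ge0 => *; rewrite lee_fin sqr_ge0.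
  apply: lee_nneseries => [*|k _].
    by apply: integral_ge0 => *; rewrite lee_fin.
  by rewrite -ge0_integralZl_EFin ?sqr_ge0// => *; rewrite lee_fin sqr_ge0.
Qed.
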